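(* Let $X=(X_{ij})\in\mathbb{R}^{m\times n}$ be a matrix whose elements are independent variables. Then: (1) $\frac{dX}{dX}=I_m\times_c I_n$. (2) $\frac{dX^\top}{dX}=I_m\times_{(2,3)}I_n=\mathcal{K}_{m,n}$. (3) If $Y=Y(X)\in\mathbb{R}^{p\times r}$ and $Z=Z(X)\in\mathbb{R}^{r\times q}$ are differentiable matrix-valued functions of $X$, then $\frac{d(YZ)}{dX}=\frac{dY}{dX}\times_4 Z+\frac{dZ}{dX}\times_3 Y^\top$. (4) If $m=n$, then $\frac{dX^2}{dX}=I_n\times_c X+X^\top\times_c I_n$. (5) If $m=n$, then for every positive integer $k$, $\frac{dX^k}{dX}=\sum_{p=0}^{k-1}\left[(X^\top)^p\times_c X^{k-1-p}\right]$.
   Context: ''Independent variables'' means that the entries $X_{ij}$ are functionally independent real variables, i.e. $\partial X_{kl}/\partial X_{ij}=\delta_{ik}\delta_{jl}$. For a matrix $Y\in\mathbb{R}^{p\times q}$ whose entries are differentiable functions of $X\in\mathbb{R}^{m\times n}$, $\frac{dY}{dX}$ is the 4-order tensor of size $m\times n\times p\times q$ with entries $\left(\frac{dY}{dX}\right)_{i_1i_2i_3i_4}=\frac{\partial Y_{i_3i_4}}{\partial X_{i_1i_2}}$. For matrices $A,B$: $(A\times_c B)_{i_1i_2i_3i_4}=A_{i_1i_3}B_{i_2i_4}$. The tensor $I_m\times_{(2,3)}I_n$ is the $m\times n\times n\times m$ tensor with entries $(I_m)_{i_1i_4}(I_n)_{i_2i_3}=\delta_{i_1i_4}\delta_{i_2i_3}$.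 The commutation tensor $\mathcal{K}_{m,n}$ is the $m\times n\times n\times m$ tensor satisfying $\mathcal{K}_{m,n}B=B^\top$ for every $B\in\mathbb{R}^{n\times m}$, where $(\mathcal{K}B)_{ij}=\sum_{k,l}\mathcal{K}_{ijkl}B_{kl}$. For a 4-order tensor $\mathcal{A}$ and a matrix $B$ of suitable sizes: $(\mathcal{A}\times_4B)_{i_1i_2i_3i_4}=\sum_k\mathcal{A}_{i_1i_2i_3k}B_{ki_4}$ and $(\mathcal{A}\times_3B)_{i_1i_2i_3i_4}=\sum_k\mathcal{A}_{i_1i_2ki_4}B_{ki_3}$. Also $X^0=I_n$. *)

(* Defs.v *)
From HB Require Import structures.
From mathcomp Require Import all_boot all_order all_algebra.
From mathcomp Require Import all_classical all_reals all_analysis.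

Set Implicit Arguments.
Unset Strict Implicit.
Unset Printing Implicit Defensive.

Import Order.TTheory GRing.Theory Num.Theory.
Import numFieldNormedType.Exports.

Local Open Scope ring_scope.

(* Fourth-order tensors of size m x n x p x q, as m x n matrices of p x q
   matrices, so that the (i1, i2, i3, i4) entry of T is [T i1 i2 i3 i4]. *)
Notation "''T[' R ]_ ( m , n , p , q )" := ('M['M[R]_(p, q)]_(m, n))
  (at level 8, m, n, p, q at level 50, only parsing) : type_scope.

(* The variable W ranges over the whole matrix space: its entries are the
   independent variables, and the partial derivative with respect to W i1 i2
   is the directional derivative along [delta_mx i1 i2].  The derivative 'D is
   total: its value is meaningful only where the entries are derivable. *)
Definition mxderive (R : realType) (m n p q : nat)
    (Y : 'M[R]_(m, n) -> 'M[R]_(p, q)) (X : 'M[R]_(m, n)) :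
    'T[R]_(m, n, p, q) :=
  \matrix_(i1, i2) \matrix_(i3, i4)
    'D_(delta_mx i1 i2) (fun W : 'M[R]_(m, n) => Y W i3 i4 : R) X.

Definition tprodc (R : realType) (m n p q : nat)
    (A : 'M[R]_(m, p)) (B : 'M[R]_(n, q)) : 'T[R]_(m, n, p, q) :=
  \matrix_(i1, i2) \matrix_(i3, i4) (A i1 i3 * B i2 i4).

Definition tprod23 (R : realType) (m n p q : nat)
    (A : 'M[R]_(m, q)) (B : 'M[R]_(n, p)) : 'T[R]_(m, n, p, q) :=
  \matrix_(i1, i2) \matrix_(i3, i4) (A i1 i4 * B i2 i3).

Definition tmode4 (R : realType) (m n p r q : nat)
    (T : 'T[R]_(m, n, p, r)) (B : 'M[R]_(r, q)) : 'T[R]_(m, n, p, q) :=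
  \matrix_(i1, i2) \matrix_(i3, i4) \sum_k T i1 i2 i3 k * B k i4.

Definition tmode3 (R : realType) (m n r p q : nat)
    (T : 'T[R]_(m, n, r, q)) (B : 'M[R]_(r, p)) : 'T[R]_(m, n, p, q) :=
  \matrix_(i1, i2) \matrix_(i3, i4) \sum_k T i1 i2 k i4 * B k i3.

Definition tapply (R : realType) (m n p q : nat)
    (T : 'T[R]_(m, n, p, q)) (B : 'M[R]_(p, q)) : 'M[R]_(m, n) :=
  \matrix_(i, j) \sum_k \sum_l T i j k l * B k l.

(* The commutation tensor is the unique tensor with this property, so that
   "K is the commutation tensor" reads [unique (@is_commutation_tensor R m n) K]. *)
Definition is_commutation_tensor (R : realType) (m n : nat)
    (K : 'T[R]_(m, n, n, m)) : Prop :=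
  forall B : 'M[R]_(n, m), tapply K B = B^T.

Notation "A '×c' B" := (tprodc A B)
  (at level 40, left associativity) : ring_scope.
Notation "A '×23' B" := (tprod23 A B)
  (at level 40, left associativity) : ring_scope.
Notation "T '×4' B" := (tmode4 T B)
  (at level 40, left associativity) : ring_scope.
Notation "T '×3' B" := (tmode3 T B)
  (at level 40, left associativity) : ring_scope.

(* Main.v *)
(* Differentiability and derivatives of matrix-valued maps are entrywise, so
   everything reduces to coordinates and the scalar product rule. For powers,
   apply the product rule to X^(k+1) = X^k X: the operation ×4 X raises the
   right factor of every term A ×c B by one power of X, while
   (I ×c I) ×3 (X^k)^T = (X^T)^k ×c I supplies the new term. *)

Require Import Defs.
From HB Require Import structures.
From mathcomp Require Import all_boot all_order all_algebra.
From mathcomp Require Import all_classical all_reals all_analysis.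
Import Order.TTheory GRing.Theory Num.Theory.
Import numFieldNormedType.Exports.
Local Open Scope ring_scope.

(** Forward: compose [Y] with the coordinate maps. Backward: [Y] is the finite sum of its scalar
    entries times the constant matrices [delta_mx i j]. *)
Lemma differentiable_mxP (R : realType) (V : normedModType R) (m n : nat)
    (Y : V -> 'M[R]_(m, n)) (x : V) :
  differentiable Y x <->
  forall i j, differentiable (fun v => Y v i j : R) x.
Proof.
split=> [dY i j|dY].
  exact: (differentiable_comp dY (differentiable_coord (Y x) i j)).
have -> : Y = \sum_(i < m) \sum_(j < n) (fun v => Y v i j *: delta_mx i j).
  apply/funext => v; rewrite fct_sumE [LHS]matrix_sum_delta.
  by apply: eq_bigr => i _; rewrite fct_sumE.
by do 2![apply: differentiable_sum => ?]; exact: differentiableZl.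
Qed.

Lemma mxderive_id (R : realType) (m n : nat) (X : 'M[R]_(m, n)) :
  mxderive (fun W : 'M[R]_(m, n) => W) X = 1%:M ×c 1%:M.
Proof.
apply/matrixP => i1 i2; apply/matrixP => i3 i4; rewrite !mxE.
(* The derivative of the identity along [delta_mx i1 i2] is [delta_mx i1 i2] itself; [derive_mx]
   reads it entry by entry. *)
have /matrixP/(_ i3 i4) := derive_mx (@derivable_id _ _ X (delta_mx i1 i2)).
rewrite derive_id !mxE => <-.
by rewrite -natrM mulnb (eq_sym i3) (eq_sym i4).
Qed.

Lemma mxderive_trmx (R : realType) (m n : nat) (X : 'M[R]_(m, n)) :
  mxderive (fun W : 'M[R]_(m, n) => W^T) X = 1%:M ×23 1%:M.
Proof.
have /matrixP dX := mxderive_id R m n X.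
apply/matrixP => i1 i2; apply/matrixP => i3 i4; rewrite !mxE.
have /matrixP/(_ i4 i3) := dX i1 i2; rewrite !mxE => <-.
by congr ('D__ _ _); apply/funext => W; rewrite mxE.
Qed.

(** Existence: the Kronecker deltas collapse the double sum to the term [k = j], [l = i].
    Uniqueness: applying a tensor to the matrix units recovers all of its entries, so its action
    determines it. *)
Lemma commutation_tensorP (R : realType) (m n : nat) :
  unique (@is_commutation_tensor R m n) (1%:M ×23 1%:M).
Proof.
have tapply_delta (K : 'T[R]_(m, n, n, m)) k l i j :
    tapply K (delta_mx k l) i j = K i j k l.
  rewrite mxE (bigD1 k)//= (bigD1 l)//= big1 ?big1 ?addr0.
  - by rewrite mxE !eqxx mulr1.
  - by move=> k' /negPf k'k; apply: big1 => l' _; rewrite mxE k'k mulr0.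
  - by move=> l' /negPf l'l; rewrite mxE l'l andbF mulr0.
have comm1 : @is_commutation_tensor R m n (1%:M ×23 1%:M).
  move=> B; apply/matrixP => i j; rewrite !mxE (bigD1 j)//= (bigD1 i)//=.
  rewrite big1 ?big1 ?addr0.
  - by rewrite !mxE !eqxx !mul1r.
  - move=> k /negPf kj; apply: big1 => l _.
    by rewrite !mxE (eq_sym j) kj mulr0 mul0r.
  - by move=> l /negPf li; rewrite !mxE (eq_sym i) li !mul0r.
split=> // K commK; apply/matrixP => i j; apply/matrixP => k l.
by rewrite -!tapply_delta comm1 commK.
Qed.

Section product_rule.
Context {R : realType} {m n p r q : nat}.
Variables (Y : 'M[R]_(m, n) -> 'M[R]_(p, r)) (Z : 'M[R]_(m, n) -> 'M[R]_(r, q)).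
Variable X : 'M[R]_(m, n).
Hypotheses (dY : differentiable Y X) (dZ : differentiable Z X).

Let dYij := (differentiable_mxP _ _ _ _ _ _).1 dY.
Let dZij := (differentiable_mxP _ _ _ _ _ _).1 dZ.

(** Each entry is put in the form of a sum of products in the ring of functions, to which the scalar
    sum and product rules apply. *)
Let mulmx_entry i j : (fun W => (Y W *m Z W) i j) =
  \sum_(k < r) ((fun W => Y W i k) * (fun W => Z W k j)).
Proof. by apply/funext => W; rewrite mxE fct_sumE. Qed.

Lemma differentiable_mulmx : differentiable (fun W => Y W *m Z W) X.
Proof.
apply/differentiable_mxP => i j; rewrite mulmx_entry.
by apply: differentiable_sum => k; apply: differentiableM.
Qed.

Lemma mxderive_mulmx :
  mxderive (fun W => Y W *m Z W) X
  = mxderive Y X ×4 Z X + mxderive Z X ×3 (Y X)^T.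
Proof.
have derivY i k v : derivable (fun W => Y W i k : R) X v.
  exact: diff_derivable.
have derivZ k j v : derivable (fun W => Z W k j : R) X v.
  exact: diff_derivable.
apply/matrixP => i1 i2; apply/matrixP => i3 i4; rewrite !mxE mulmx_entry.
rewrite derive_sum => [|k]; last exact: derivableM.
rewrite -big_split; apply: eq_bigr => k _.
(* [deriveM] puts the derivative of the second factor first and the undifferentiated factors on the
   left, hence both commutations. *)
by rewrite deriveM//= !mxE addrC; congr (_ + _); exact: mulrC.
Qed.

End product_rule.

Section tmode_tprodc.
Context {R : realType} {m n : nat}.

(** The fourth index of [A ×c B] is the column index of [B], so contracting it only affects [B];
    likewise the third index and [A] in [tmode3_prodc]. *)
Lemma tmode4_prodc p r q (A : 'M[R]_(m, p)) (B : 'M[R]_(n, r))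
    (C : 'M[R]_(r, q)) : (A ×c B) ×4 C = A ×c (B *m C).
Proof.
apply/matrixP => i1 i2; apply/matrixP => i3 i4; rewrite !mxE mulr_sumr.
by apply: eq_bigr => k _; rewrite !mxE mulrA.
Qed.

Lemma tmode3_prodc p r q (A : 'M[R]_(m, r)) (B : 'M[R]_(n, q))
    (C : 'M[R]_(r, p)) : (A ×c B) ×3 C = (A *m C) ×c B.
Proof.
apply/matrixP => i1 i2; apply/matrixP => i3 i4; rewrite !mxE mulr_suml.
by apply: eq_bigr => k _; rewrite !mxE mulrAC.
Qed.

Lemma tmode4_sum p r q (I : Type) (s : seq I) (T : I -> 'T[R]_(m, n, p, r))
    (C : 'M[R]_(r, q)) :
  (\sum_(i <- s) T i) ×4 C = \sum_(i <- s) (T i ×4 C).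
Proof.
apply/matrixP => i1 i2; apply/matrixP => i3 i4.
rewrite mxE mxE !summxE; under eq_bigr do rewrite !summxE mulr_suml.
by rewrite exchange_big; apply: eq_bigr => i _; rewrite !mxE.
Qed.

End tmode_tprodc.

Lemma trmxX (R : realType) (n k : nat) (X : 'M[R]_n) : (X ^+ k)^T = X^T ^+ k.
Proof.
elim: k => [|k IHk]; first by rewrite !expr0 trmx1.
(* Transposition reverses products, so the last factor is split off on the left-hand side and the
   first one on the right-hand side. *)
by rewrite exprSr exprS -IHk [LHS]trmx_mul.
Qed.

Section power_rule.
Context {R : realType} {n : nat}.
Implicit Type X : 'M[R]_n.

Lemma differentiable_mxX k X : differentiable (fun W : 'M[R]_n => W ^+ k) X.
Proof.
elim: k => [|k IHk]; first exact: differentiable_cst.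
under eq_fun do rewrite exprSr; exact: differentiable_mulmx.
Qed.

Lemma mxderiveX k X : mxderive (fun W : 'M[R]_n => W ^+ k) X =
  \sum_(0 <= p < k) (X^T ^+ p ×c X ^+ (k - 1 - p)).
Proof.
elim: k => [|k IHk].
  rewrite big_geq//; apply/matrixP => i1 i2; apply/matrixP => i3 i4.
  (* The zeroth power is constant and the sum is empty; unfolding the zero tensor to nested constant
     matrices lets [mxE] compute its entry. *)
  by rewrite mxE mxE derive_cst -[RHS]/(const_mx (const_mx 0) i1 i2 i3 i4) !mxE.
under eq_fun do rewrite exprSr.
rewrite (mxderive_mulmx _ _ _ (differentiable_mxX k X))// IHk mxderive_id.
(* The last summand, [p = k], has right exponent 0 and is the new term of the product rule. *)
rewrite tmode4_sum tmode3_prodc mul1mx trmxX big_nat_recr//= !subn1 /= subnn.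
congr (_ + _); apply: eq_big_nat => p /andP[_ pk].
rewrite tmode4_prodc; congr (_ ×c _).
(* Subtraction is truncated: [p < k] makes [k - p] a successor, so the extra factor [X] raises the
   exponent from [k - 1 - p] to [k - p]. *)
by rewrite -subn1 subnAC -[(k - p)%N]prednK ?subn_gt0// subn1 exprSr.
Qed.

End power_rule.

Theorem theorem2p5 (R : realType) (m n : nat) :
  (forall X : 'M[R]_(m, n),
     differentiable (fun W : 'M[R]_(m, n) => W) X /\
     mxderive (fun W : 'M[R]_(m, n) => W) X
       = (1%:M : 'M[R]_m) ×c (1%:M : 'M[R]_n)) /\
  (forall X : 'M[R]_(m, n),
     differentiable (fun W : 'M[R]_(m, n) => W^T) X /\
     mxderive (fun W : 'M[R]_(m, n) => W^T) X
       = (1%:M : 'M[R]_m) ×23 (1%:M : 'M[R]_n) /\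
     unique (@is_commutation_tensor R m n)
       ((1%:M : 'M[R]_m) ×23 (1%:M : 'M[R]_n))) /\
  (forall (p r q : nat) (Y : 'M[R]_(m, n) -> 'M[R]_(p, r))
      (Z : 'M[R]_(m, n) -> 'M[R]_(r, q)) (X : 'M[R]_(m, n)),
     differentiable Y X -> differentiable Z X ->
     differentiable (fun W : 'M[R]_(m, n) => Y W *m Z W) X /\
     mxderive (fun W : 'M[R]_(m, n) => Y W *m Z W) X
       = mxderive Y X ×4 Z X + mxderive Z X ×3 (Y X)^T) /\
  (forall X : 'M[R]_n,
     differentiable (fun W : 'M[R]_n => W ^+ 2) X /\
     mxderive (fun W : 'M[R]_n => W ^+ 2) X
       = (1%:M : 'M[R]_n) ×c X + X^T ×c (1%:M : 'M[R]_n)) /\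
  (forall (X : 'M[R]_n) (k : nat), (0 < k)%N ->
     differentiable (fun W : 'M[R]_n => W ^+ k) X /\
     mxderive (fun W : 'M[R]_n => W ^+ k) X
       = \sum_(0 <= p < k) (X^T ^+ p ×c X ^+ (k - 1 - p))).
Proof.
split; first by move=> X; split=> //; exact: mxderive_id.
split.
  move=> X; split; last by split; [exact: mxderive_trmx|exact: commutation_tensorP].
  apply/differentiable_mxP => i j; under eq_fun do rewrite mxE.
  exact: differentiable_coord.
split.
  by move=> p r q Y Z X dY dZ; split; [exact: differentiable_mulmx|exact: mxderive_mulmx].
split=> [X|X k _]; split; try exact: differentiable_mxX.
  (* For exponent 2 the terms [p = 0] and [p = 1] are the two summands, in this order. *)
  by rewrite mxderiveX !big_nat_recr//= big_geq// add0r expr0 !expr1.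
exact: mxderiveX.
Qed.
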